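(* Let $(\mu,\ell,\mathcal{W},\mathcal{A})$ be a learning tuple and let $n\ge1$, with sample $\mathcal{S}_n=(Z_1,\dots,Z_n)$ i.i.d. from $\mu$ and output hypothesis $W$ of $\mathcal{A}$ on $\mathcal{S}_n$. Assume that the learning tuple satisfies the expected $(\eta,c)$-central condition for some constants $\eta>0$ and $0<c\le 1$. Then for all $\eta'\in(0,\eta]$, $$\mathbb{E}_{W\mathcal{S}_n}\left[\mathcal{E}(W,\mathcal{S}_n)\right]\le \frac{1-c}{c}\,\mathbb{E}_{P_{W\mathcal{S}_n}}\left[\hat{\mathcal{R}}(W,\mathcal{S}_n)\right]+\frac{1}{c\eta' n}\sum_{i=1}^n I(W;Z_i).$$ Furthermore, $$\mathbb{E}_{W}\left[\mathcal{R}(W)\right]\le \frac{1}{c}\,\mathbb{E}_{P_{W\mathcal{S}_n}}\left[\hat{\mathcal{R}}(W,\mathcal{S}_n)\right]+\frac{1}{c\eta' n}\sum_{i=1}^n I(W;Z_i).$$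
   Context: Setting. $\mathcal{Z}$ is the instance space, $\mu$ a probability distribution on $\mathcal{Z}$, $\mathcal{W}$ the hypothesis space, $\ell:\mathcal{W}\times\mathcal{Z}\to\mathbb{R}$ a loss function. The sample $\mathcal{S}_n=(Z_1,\dots,Z_n)$ consists of i.i.d. draws from $\mu$. A (possibly randomised) algorithm $\mathcal{A}:\mathcal{Z}^n\to\mathcal{W}$, i.e. a conditional distribution $P_{W|\mathcal{S}_n}$, produces the hypothesis $W$. The tuple $(\mu,\ell,\mathcal{W},\mathcal{A})$ is called a learning tuple. $P_{W\mathcal{S}_n}$ is the induced joint law of $(W,\mathcal{S}_n)$, $P_{WZ_i}$ the induced joint law of $(W,Z_i)$, and $P_W$ the induced marginal law of $W$. Under $P_W\otimes\mu$, $W\sim P_W$ and $Z\sim\mu$ are independent. $\mathbb{E}_{W\mathcal{S}_n}=\mathbb{E}_{P_{W\mathcal{S}_n}}$ and $\mathbb{E}_W$ denote expectation under $P_{W\mathcal{S}_n}$ and $P_W$. Definitions. $w^*\in\arg\min_{w\in\mathcal{W}}\mathbb{E}_{Z\sim\mu}[\ell(w,Z)]$ is an optimal hypothesis; $r(w,z)=\ell(w,z)-\ell(w^*,z)$. Generalization error: $\mathcal{E}(w,\mathcal{S}_n)=\mathbb{E}_{Z\sim\mu}[\ell(w,Z)]-\frac1n\sum_{i=1}^n\ell(w,Z_i)$. Excess risk: $\mathcal{R}(w)=\mathbb{E}_{Z\sim\mu}[\ell(w,Z)]-\mathbb{E}_{Z\sim\mu}[\ell(w^*,Z)]$. Empirical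 excess risk: $\hat{\mathcal{R}}(w,\mathcal{S}_n)=\frac1n\sum_{i=1}^n r(w,Z_i)$. $I(W;Z_i)=D(P_{WZ_i}\,\|\,P_W\otimes\mu)$ is the mutual information (KL divergence, natural logarithm). Expected $(\eta,c)$-central condition (for constants $\eta>0$, $0<c\le1$): $$\log\mathbb{E}_{P_W\otimes\mu}\left[e^{-\eta(\ell(W,Z)-\ell(w^*,Z))}\right]\le -c\,\eta\,\mathbb{E}_{P_W\otimes\mu}\left[\ell(W,Z)-\ell(w^*,Z)\right].$$ *)

(* Defs.v *)
From HB Require Import structures.
From mathcomp Require Import all_boot all_order all_algebra.
From mathcomp Require Import all_classical all_reals all_analysis.
From mathcomp Require Import measurable_realfun.

Set Implicit Arguments.
Unset Strict Implicit.
Unset Printing Implicit Defensive.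

Import Order.TTheory GRing.Theory Num.Theory.
Import numFieldNormedType.Exports.

Local Open Scope classical_set_scope.
Local Open Scope ring_scope.
Local Open Scope ereal_scope.

Section cons_pair.
Context d (T : measurableType d) (n : nat).

Definition cons_pair (x : T * n.-tuple T) : n.+1.-tuple T :=
  [the n.+1.-tuple T of x.1 :: x.2].

Let measurable_cons_pair : measurable_fun [set: T * n.-tuple T] cons_pair.
Proof. exact: (measurable_cons measurable_fst measurable_snd). Qed.

HB.instance Definition _ :=
  isMeasurableFun.Build _ _ _ _ cons_pair measurable_cons_pair.

End cons_pair.

(* The law mu^n of n i.i.d. draws from mu. *)
Fixpoint iid d (T : measurableType d) (R : realType) (mu : probability T R)
    (n : nat) : probability (n.-tuple T) R :=
  match n with
  | 0 => \d_[tuple]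
  | m.+1 => distribution (mu \x iid mu m)%E (@cons_pair d T m)
  end.

Section joint.
Context d1 d2 (S : measurableType d1) (W : measurableType d2) (R : realType).
Variables (P : probability S R) (k : R.-pker S ~> W).

(* Joint law of (w, s) where s has law P and, given s, w has law k s;
   ysection B s is the set of w with (w, s) in B. *)
Definition joint (B : set (W * S)) : \bar R := \int[P]_s k s (ysection B s).

Let joint0 : joint set0 = 0.
Proof.
by apply: integral0_eq => s _; rewrite ysection0 measure0.
Qed.

Let joint_ge0 B : 0 <= joint B.
Proof. by apply: integral_ge0 => s _; exact: measure_ge0. Qed.

Let measurable_k_ysection (B : set (W * S)) : measurable B ->
  measurable_fun [set: S] (fun s => k s (ysection B s)).
Proof.
move=> mB.
have mB' : measurable ((fun x : S * W => (x.2, x.1)) @^-1` B).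
  rewrite -[X in measurable X]setTI.
  exact: (measurable_fun_pair measurable_snd measurable_fst measurableT mB).
have -> : (fun s => k s (ysection B s)) =
    kfcomp k (EFin \o \1_((fun x : S * W => (x.2, x.1)) @^-1` B)).
  by rewrite kfcompkindic//; apply/funext => s; rewrite xsectionE ysectionE.
apply: measurable_kfcomp => //.
  by apply/measurable_EFinP; exact: measurable_indic.
by move=> x; rewrite lee_fin.
Qed.

Let joint_sigma_additive : semi_sigma_additive joint.
Proof.
move=> F mF tF mUF.
have -> : joint (\bigcup_n F n) =
    \int[P]_s (\sum_(0 <= i <oo) k s (ysection (F i) s)).
  apply: eq_integral => s _; rewrite ysection_bigcup measure_bigcup//=.
  - by apply: eq_eseriesl => i; rewrite in_setT.
  - by move=> i _; exact: measurable_ysection.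
  - exact: trivIset_ysection.
have -> : (fun n => \sum_(0 <= i < n) joint (F i)) =
    (fun n => \int[P]_s (\sum_(0 <= i < n) k s (ysection (F i) s))).
  apply/funext => n; rewrite ge0_integral_sum// => i.
  exact: measurable_k_ysection.
apply: cvg_monotone_convergence => //.
- by move=> n; apply: emeasurable_sum => i; exact: measurable_k_ysection.
- by move=> n s _; apply: sume_ge0 => i _; exact: measure_ge0.
- by move=> s _ a b ab; apply: ereal_nondecreasing_series.
Qed.

HB.instance Definition _ := isMeasure.Build _ _ _ joint
  joint0 joint_ge0 joint_sigma_additive.

Let joint_setT : joint [set: W * S] = 1.
Proof.
have -> : joint setT = \int[P]_s cst 1 s.
  apply: eq_integral => s _.
  by rewrite ysectionE preimage_setT prob_kernel.
rewrite integral_cst// mul1e.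
exact: probability_setT.
Qed.

HB.instance Definition _ :=
  Measure_isProbability.Build _ _ _ joint joint_setT.

End joint.

Section eval_coord.
Context d1 d2 (W : measurableType d1) (Z : measurableType d2) (n : nat).

Definition hyp_of (x : W * n.-tuple Z) : W := x.1.

Definition hyp_coord (i : 'I_n) (x : W * n.-tuple Z) : W * Z :=
  (x.1, tnth x.2 i).

Let measurable_hyp_of : measurable_fun [set: W * n.-tuple Z] hyp_of.
Proof. exact: measurable_fst. Qed.

HB.instance Definition _ :=
  isMeasurableFun.Build _ _ _ _ hyp_of measurable_hyp_of.

Let measurable_hyp_coord i :
  measurable_fun [set: W * n.-tuple Z] (hyp_coord i).
Proof.
apply: measurable_fun_pair; first exact: measurable_fst.
exact: (measurableT_comp (measurable_tnth i) measurable_snd).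
Qed.

HB.instance Definition _ i :=
  isMeasurableFun.Build _ _ _ _ (hyp_coord i) (measurable_hyp_coord i).

End eval_coord.

Section laws.
Context dW dZ (W : measurableType dW) (Z : measurableType dZ) (R : realType).
Variables (mu : probability Z R) (n : nat) (A : R.-pker (n.-tuple Z) ~> W).

Definition law_WS : probability (W * n.-tuple Z)%type R := joint (iid mu n) A.

Definition law_W : probability W R := distribution law_WS (@hyp_of _ _ W Z n).

Definition law_WZ (i : 'I_n) : probability (W * Z)%type R :=
  distribution law_WS (@hyp_coord _ _ W Z n i).

Definition law_W_indep_Z : probability (W * Z)%type R := (law_W \x mu)%E.

End laws.

Section KL.
Context d (T : measurableType d) (R : realType).
Local Open Scope charge_scope.

(* D(P || Q) with the natural logarithm; +oo when P is not absolutely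
   continuous with respect to Q. *)
Definition kl_div (P Q : probability T R) : \bar R :=
  if `[< P `<< Q >]
  then \int[P]_x lne (('d (charge_of_finite_measure P) '/d Q) x)
  else +oo.

End KL.

Definition mutual_info dW dZ (W : measurableType dW) (Z : measurableType dZ)
    (R : realType) (mu : probability Z R) (n : nat)
    (A : R.-pker (n.-tuple Z) ~> W) (i : 'I_n) : \bar R :=
  kl_div (law_WZ mu A i) (law_W_indep_Z mu A).

Section risks.
Context dZ (W : Type) (Z : measurableType dZ) (R : realType).
Variables (mu : probability Z R) (l : W -> Z -> R).

Definition risk (w : W) : \bar R := 'E_mu[l w].

(* The minimum is over extended reals. An integral of the form +oo - +oo
   evaluates to -oo, so if l wstar is integrable and wstar is optimal then
   every hypothesis has a well-defined risk in ]-oo, +oo]. *)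
Definition optimal_hyp (wstar : W) : Prop :=
  forall w : W, risk wstar <= risk w.

Definition gen_error (n : nat) (w : W) (s : n.-tuple Z) : \bar R :=
  risk w - (n%:R^-1 * \sum_(i < n) l w (tnth s i))%R%:E.

Variable wstar : W.

Definition rel_loss (w : W) (z : Z) : R := (l w z - l wstar z)%R.

Definition excess_risk (w : W) : \bar R := risk w - risk wstar.

Definition emp_excess_risk (n : nat) (w : W) (s : n.-tuple Z) : R :=
  (n%:R^-1 * \sum_(i < n) rel_loss w (tnth s i))%R.

End risks.

(* lne is the logarithm on extended reals (lne +oo = +oo), so the inequality
   includes the finiteness of the exponential moment whenever the right-hand
   side is finite. *)
Definition expected_central dW dZ (W : measurableType dW)
    (Z : measurableType dZ) (R : realType) (mu : probability Z R)
    (l : W -> Z -> R) (n : nat) (A : R.-pker (n.-tuple Z) ~> W) (wstar : W)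
    (eta c : R) : Prop :=
  lne 'E_(law_W_indep_Z mu A)[fun x => expR (- eta * rel_loss l wstar x.1 x.2)]
  <= (- c * eta)%:E *
     'E_(law_W_indep_Z mu A)[fun x => rel_loss l wstar x.1 x.2].

(* Main.v *)
(* With r = l - l(wstar), the Donsker-Varadhan inequality
   E_P[f] - log E_Q[exp f] <= D(P || Q), for P = P_{W Z_i}, Q = P_W (x) mu and
   f = - eta r, combines with the central condition into
   eta (c E_Q[r] - E_P[r]) <= I(W; Z_i).  Averaging over i bounds the expected
   excess risk E_Q[r], and the expected generalization error is E_Q[r] minus
   the expected empirical excess risk, because every Z_i has law mu.
   Donsker-Varadhan follows from log q >= g + 1 - exp g / q, with q = dP/dQ
   and g = f - log E_Q[exp f]: this lower bound is P-integrable even when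
   log q is not. *)
Require Import Defs.
From HB Require Import structures.
From mathcomp Require Import all_boot all_order all_algebra.
From mathcomp Require Import all_classical all_reals all_analysis.
From mathcomp Require Import measurable_realfun ring.

Import Order.TTheory GRing.Theory Num.Theory.
Import numFieldNormedType.Exports.

Local Open Scope classical_set_scope.
Local Open Scope ring_scope.
Local Open Scope ereal_scope.

(** * Preliminaries on integrals and the extended logarithm *)

(** Positive and negative parts are compared separately, and subtraction on extended reals is
    monotone even at infinity. No integrability is asked for, since the logarithm of a density may
    fail to be integrable. *)
Lemma ae_le_integral d (T : measurableType d) (R : realType)
    (P : {measure set T -> \bar R}) (f g : T -> \bar R) :
  measurable_fun setT f -> measurable_fun setT g ->
  {ae P, forall x, f x <= g x} -> \int[P]_x f x <= \int[P]_x g x.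
Proof.
move=> mf mg fg; rewrite integralE [leRHS]integralE; apply: leeB.
- apply: ae_ge0_le_integral => //; try exact: measurable_funepos.
  apply: filterS fg => x fgx _.
  by rewrite !funeposE ge_max le_max fgx /= le_max lexx orbT.
- apply: ae_ge0_le_integral => //; try exact: measurable_funeneg.
  apply: filterS fg => x fgx _.
  by rewrite !funenegE ge_max le_max leeN2 fgx /= le_max lexx orbT.
Qed.

Lemma measurable_lne (R : realType) : measurable_fun [set: \bar R] (@lne R).
Proof.
rewrite (_ : @lne R = fun x : \bar R => if x <= 0 then -oo else
    if x < +oo then (ln (fine x))%:E else +oo); last first.
  by apply/funext => -[r| |]; rewrite ?lee_fin ?ltry ?leNye ?ltxx ?leye_eq.
apply: measurable_fun_ifT => //.
  exact: measurable_fun_lee.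
apply: measurable_fun_ifT => //.
  exact: measurable_fun_lte.
by apply/measurable_EFinP; exact: measurableT_comp.
Qed.

Lemma probability_integral_cst d (T : measurableType d) (R : realType)
    (P : probability T R) (r : R) : \int[P]_x (EFin \o cst r) x = r%:E.
Proof.
rewrite -[LHS]/(\int[P]_x cst r%:E x) integral_cst//.
by rewrite -[RHS]mule1; congr (_ * _); exact: probability_setT.
Qed.

Arguments probability_integral_cst {d T R}.

(** * Variational lower bounds on the KL divergence *)

Section kl_div_ge.
Context d (T : measurableType d) (R : realType) (P Q : probability T R).
Local Open Scope charge_scope.

(** Donsker-Varadhan normalised by [E_Q[exp g] <= 1]: the correction [1 - exp g / q] then has
    nonnegative mean under [P]. *)
Lemma kl_div_ge_integral (g : T -> R) :
  P.-integrable setT (EFin \o g) -> \int[Q]_x (expR (g x))%:E <= 1 ->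
  \int[P]_x (g x)%:E <= kl_div P Q.
Proof.
move=> ig Qg; rewrite /kl_div; case: asboolP => [PQ|_]; last exact: leey.
have mg : measurable_fun setT g by apply/measurable_EFinP; case/integrableP: ig.
(* [p] is a version of the density that is finite and nonnegative everywhere; it is matched almost
   everywhere with the derivative in [kl_div] at the end. *)
pose p := Radon_Nikodym_SigmaFinite.f P Q.
have p_ge0 x : 0 <= p x by exact: Radon_Nikodym_SigmaFinite.f_ge0.
have p_fin x : p x \is a fin_num by exact: Radon_Nikodym_SigmaFinite.f_fin_num.
have mp : measurable_fun setT p.
  exact/measurable_int/(Radon_Nikodym_SigmaFinite.f_integrable PQ).
pose q x := fine (p x).
have pE x : p x = (q x)%:E by rewrite fineK.
have q_ge0 x : (0 <= q x)%R by rewrite -lee_fin -pE.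
have mq : measurable_fun setT q by exact: measurableT_comp.
have q_gt0 : {ae P, forall x, (0 < q x)%R}.
  exists (q @^-1` [set 0%R]); split.
  - by rewrite -[X in measurable X]setTI; exact: mq.
  - rewrite (Radon_Nikodym_SigmaFinite.f_integral PQ); last first.
      by rewrite -[X in measurable X]setTI; exact: mq.
    by apply: integral0_eq => x; rewrite -/p pE /= => ->.
  - by move=> x /= /negP; rewrite -leNgt => qx; apply/eqP; rewrite eq_le qx q_ge0.
(* e = exp g / q where q > 0; writing it through ln avoids dividing by q, and
   ln 0 = 0 makes it finite on the P-null set where q = 0. *)
pose e x := expR (g x - ln (q x))%R.
have me : measurable_fun setT e.
  apply: measurableT_comp => //; apply: measurable_funB => //.
  exact: measurableT_comp.
(* Over [Q] the integrand becomes [e * p], equal to [exp g] where [q > 0] and to 0 where [q = 0];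
   hence only an inequality. *)
have e_int : \int[P]_x (e x)%:E <= 1.
  rewrite -(Radon_Nikodym_SigmaFinite.change_of_variables PQ)//; last 2 first.
  - by move=> x; rewrite lee_fin expR_ge0.
  - exact/measurable_EFinP.
  apply: le_trans Qg; apply: ge0_le_integral => //.
  - by move=> x _; rewrite mule_ge0// lee_fin expR_ge0.
  - by apply: emeasurable_funM => //; exact/measurable_EFinP.
  - by apply/measurable_EFinP; exact: measurableT_comp.
  - move=> x _; rewrite -/p pE -EFinM lee_fin /e.
    have [->|qx] := eqVneq (q x) 0%R; first by rewrite mulr0 expR_ge0.
    have qx0 : (0 < q x)%R by rewrite lt_neqAle eq_sym qx q_ge0.
    by rewrite expRD expRN lnK// mulfVK.
have ie : P.-integrable setT (EFin \o e).
  apply/integrableP; split; first exact/measurable_EFinP.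
  under eq_integral do rewrite /= ger0_norm ?expR_ge0//.
  exact: le_lt_trans e_int (ltry _).
have i1 : P.-integrable setT (EFin \o cst 1%R).
  exact: finite_measure_integrable_cst.
have ig1 : P.-integrable setT ((EFin \o g) \+ (EFin \o cst 1%R)).
  exact: integrableD.
apply: (@le_trans _ _ (\int[P]_x (g x + 1 - e x)%:E)).
  under [leRHS]eq_integral do rewrite EFinB EFinD.
  rewrite (integralB _ ig1 ie)// (integralD _ ig i1)//.
  rewrite probability_integral_cst.
  by rewrite -addeA leeDl// sube_ge0// orbT.
apply: ae_le_integral.
- by apply/measurable_EFinP; apply: measurable_funB => //; exact: measurable_funD.
- apply: measurableT_comp; first exact: measurable_lne.
  by apply: measurable_int; exact: Radon_Nikodym_integrable.
(* The two versions of the density agree [Q]-almost everywhere, so also [P]-almost everywhere by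
   absolute continuity. What remains is [1 + u <= expR u] at [u = g x - ln (q x)]. *)
have := null_dominates_ae_eq measurableT PQ
  (ae_eq_Radon_Nikodym_SigmaFinite PQ measurableT).
apply: filterS2 q_gt0 => x qx /(_ I) <-.
rewrite -/p pE lne_EFin// lee_fin lerBlDr -lerBlDl.
by rewrite addrAC addrC; exact: expR_ge1Dx.
Qed.

(** The shift [f - m] reduces to the normalised case. An upper bound [m] on the log-moment suffices,
    which is what the central condition provides. *)
Lemma kl_div_ge_exp_moment (f : T -> R) (m : R) :
  P.-integrable setT (EFin \o f) ->
  \int[Q]_x (expR (f x))%:E <= (expR m)%:E ->
  \int[P]_x (f x)%:E - m%:E <= kl_div P Q.
Proof.
move=> fi Qf; have mf : measurable_fun setT f.
  by apply/measurable_EFinP; case/integrableP: fi.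
have im : P.-integrable setT (EFin \o cst m).
  exact: finite_measure_integrable_cst.
have -> : \int[P]_x (f x)%:E - m%:E = \int[P]_x (f x - m)%:E.
  under [RHS]eq_integral do rewrite EFinB.
  rewrite (integralB _ fi im)//.
  by rewrite probability_integral_cst.
apply: kl_div_ge_integral.
  exact: (integrableB _ fi im).
under eq_integral do rewrite expRD mulrC EFinM.
rewrite ge0_integralZl//; last first.
  by apply/measurable_EFinP; exact: measurableT_comp.
apply: (@le_trans _ _ ((expR (- m))%:E * (expR m)%:E)).
  by rewrite lee_wpmul2l// lee_fin expR_ge0.
by rewrite -EFinM lee_fin -expRD addNr expR0.
Qed.

(** Gibbs' inequality, from the constant test function 0. *)
Lemma kl_div_ge0 : 0 <= kl_div P Q.
Proof.
have -> : 0 = \int[P]_x (cst 0%R x)%:E :> \bar R by rewrite integral0.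
apply: kl_div_ge_integral; first exact: integrable0.
under eq_integral do rewrite /= expR0.
by rewrite (probability_integral_cst Q 1).
Qed.

End kl_div_ge.

Arguments kl_div_ge0 {d T R}.
Arguments kl_div_ge_exp_moment {d T R} P Q {f m}.

(** * Change of variables along measure-preserving maps *)

Section measure_preserving.
Context d d' (T : measurableType d) (T' : measurableType d') (R : realType).
Variables (P : {measure set T -> \bar R}) (Q : {measure set T' -> \bar R}).
Variable phi : T -> T'.
Hypothesis mphi : measurable_fun setT phi.
Hypothesis phiE : forall B, measurable B -> P (phi @^-1` B) = Q B.

Let X : {mfun T >-> T'} := HB.pack phi (isMeasurableFun.Build _ _ _ _ _ mphi).

Let integral_pushforwardE f :
  \int[pushforward P X]_x f x = \int[Q]_x f x.
Proof. by apply: eq_measure_integral => B mB _; exact: phiE. Qed.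

(** Only measures of preimages enter, through [phiE], so this serves laws that are images by
    definition as well as projections onto [mu], whose law has to be computed. *)
Lemma integrable_measure_preserving f :
  Q.-integrable setT f -> P.-integrable setT (f \o phi).
Proof.
move=> /integrableP[mf fi]; apply/integrableP; split.
  exact: measurableT_comp.
rewrite [ltLHS](_ : _ = \int[P]_(x in X @^-1` setT) ((abse \o f) \o X) x)//.
rewrite -ge0_integral_pushforward ?integral_pushforwardE//.
- exact: measurableT_comp.
- by move=> x _ /=; exact: abse_ge0.
Qed.

Lemma integral_measure_preserving f :
  Q.-integrable setT f -> \int[P]_x (f \o phi) x = \int[Q]_x f x.
Proof.
move=> fi; have mf := measurable_int _ fi.
rewrite -[LHS]/(\int[P]_(x in X @^-1` setT) (f \o X) x).
rewrite -integral_pushforward ?integral_pushforwardE//.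
exact: integrable_measure_preserving.
Qed.

End measure_preserving.

Arguments integrable_measure_preserving {d d' T T' R P Q phi} mphi phiE {f}.
Arguments integral_measure_preserving {d d' T T' R P Q phi} mphi phiE {f}.

(** * The instance marginal of both joint laws *)

Section marginals.
Context dW dZ (W : measurableType dW) (Z : measurableType dZ) (R : realType).
Variable mu : probability Z R.

(** By induction on [n]: an event on the first coordinate is a cylinder over the factor [mu], and
    one on a later coordinate is a cylinder over the remaining tuple. *)
Lemma iid_tnth n (i : 'I_n) (B : set Z) : measurable B ->
  iid mu n ((fun s => tnth s i) @^-1` B) = mu B.
Proof.
move=> mB; elim: n i => [[]//|n ih] i.
rewrite /= /distribution /pushforward.
have [->|[j ->]] : i = ord0 \/ exists j, i = lift ord0 j.
  by case: (unliftP ord0 i) => [j ->|->]; [right; exists j|left].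
- rewrite (_ : _ @^-1` _ = B `*` setT); last first.
    by apply/seteqP; split => x /=; rewrite /cons_pair /= (tnth_nth x.1)//= => -[].
  rewrite product_measure1E// -[RHS]mule1; congr (_ * _).
  exact: probability_setT.
- rewrite (_ : _ @^-1` _ =
      setT `*` ((fun s : n.-tuple Z => tnth s j) @^-1` B)); last first.
    apply/seteqP; split => x /=.
      by rewrite !(tnth_nth x.1).
    by rewrite !(tnth_nth x.1) => -[].
  rewrite product_measure1E//; last first.
    by rewrite -[X in measurable X]setTI; exact: measurable_tnth.
  by rewrite -[RHS]mul1e; congr (_ * _); [exact: probability_setT|exact: ih].
Qed.

Variables (n : nat) (A : R.-pker (n.-tuple Z) ~> W).

(** The event ignores [w], so each section is full or empty, and the kernel, of mass one,
    contributes the indicator of the event on [s]. *)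
Lemma law_WZ_snd (i : 'I_n) (B : set Z) : measurable B ->
  law_WZ mu A i (snd @^-1` B) = mu B.
Proof.
move=> mB; rewrite -(iid_tnth _ i _ mB) /law_WZ /distribution /pushforward /law_WS.
rewrite -[LHS]/(\int[iid mu n]_s A s (ysection
  ([set x : W * n.-tuple Z | B (tnth x.2 i)]) s)).
rewrite -[X in iid _ _ X]setIT -integral_indic//; last first.
  by rewrite -[X in measurable X]setTI; exact: measurable_tnth.
apply: eq_integral => s _; rewrite indicE.
have [sB|sB] := boolP (s \in _).
  rewrite (_ : ysection _ _ = setT) ?prob_kernel//.
  by apply/seteqP; split => // w _; rewrite /ysection/= inE/=; rewrite inE in sB.
rewrite (_ : ysection _ _ = set0) ?measure0//.
apply/seteqP; split => // w; rewrite /ysection/= inE/= => sB'.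
by move/negP : sB; apply; rewrite inE.
Qed.

Lemma law_W_indep_Z_snd (B : set Z) : measurable B ->
  law_W_indep_Z mu A (snd @^-1` B) = mu B.
Proof.
move=> mB; rewrite (_ : _ @^-1` _ = setT `*` B); last first.
  by apply/seteqP; split => x //= -[].
rewrite [LHS]product_measure1E// -[RHS]mul1e; congr (_ * _).
exact: probability_setT.
Qed.

End marginals.

Arguments law_WZ_snd {dW dZ W Z R mu n}.
Arguments law_W_indep_Z_snd {dW dZ W Z R mu n}.

(** * From the central condition to the two risk bounds *)

Theorem theorem4 (R : realType) (dW dZ : measure_display)
    (W : measurableType dW) (Z : measurableType dZ)
    (mu : probability Z R) (l : W -> Z -> R)
    (n : nat) (A : R.-pker (n.-tuple Z) ~> W)
    (wstar : W) (eta c : R) :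
  measurable_fun [set: W * Z] (fun x => l x.1 x.2) ->
  (1 <= n)%N ->
  mu.-integrable [set: Z] (fun z => (l wstar z)%:E) ->
  (law_W_indep_Z mu A).-integrable [set: W * Z]
    (fun x => (l x.1 x.2)%:E) ->
  (forall i : 'I_n, (law_WZ mu A i).-integrable [set: W * Z]
    (fun x => (l x.1 x.2)%:E)) ->
  optimal_hyp mu l wstar ->
  (0 < eta)%R -> (0 < c)%R -> (c <= 1)%R ->
  expected_central mu l A wstar eta c ->
  forall eta' : R, (0 < eta')%R -> (eta' <= eta)%R ->
    \int[law_WS mu A]_x gen_error mu l x.1 x.2
      <= ((1 - c) / c)%R%:E *
           'E_(law_WS mu A)[fun x => emp_excess_risk l wstar x.1 x.2]
         + ((c * eta' * n%:R)^-1)%R%:E *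
           \sum_(i < n) mutual_info mu A i
    /\
    \int[law_W mu A]_w excess_risk mu l wstar w
      <= (c^-1)%R%:E *
           'E_(law_WS mu A)[fun x => emp_excess_risk l wstar x.1 x.2]
         + ((c * eta' * n%:R)^-1)%R%:E *
           \sum_(i < n) mutual_info mu A i.
Proof.
move=> _ n_gt0 ilstar iQ iP _ eta_gt0 c_gt0 _ central eta' eta'_gt0 eta'_le.
set Q := law_W_indep_Z mu A in iQ *.
pose P := law_WZ mu A.
pose r (x : W * Z) := rel_loss l wstar x.1 x.2.
have ilQ : Q.-integrable setT (fun x => (l wstar x.2)%:E).
  exact: (integrable_measure_preserving measurable_snd
    (law_W_indep_Z_snd A) ilstar).
have ilP i : (P i).-integrable setT (fun x => (l wstar x.2)%:E).
  exact: (integrable_measure_preserving measurable_snd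
    (law_WZ_snd A i) ilstar).
(* The real numbers [s], [L] and [a i] below reduce the theorem to arithmetic. Since [Z] has law
   [mu] under [Q] and every [P i], the same [s] is subtracted in [E_Q[r] = L - s] and [E_(P i)[r] =
   a i - s]. *)
pose s := fine (risk mu l wstar).
have risk_star : risk mu l wstar = s%:E.
  by rewrite fineK// /risk unlock; exact: (integrable_fin_num measurableT ilstar).
have intlQ : \int[Q]_x (l wstar x.2)%:E = s%:E.
  rewrite -risk_star /risk unlock.
  exact: (integral_measure_preserving measurable_snd
    (law_W_indep_Z_snd A) ilstar).
have intlP i : \int[P i]_x (l wstar x.2)%:E = s%:E.
  rewrite -risk_star /risk unlock.
  exact: (integral_measure_preserving measurable_snd
    (law_WZ_snd A i) ilstar).
pose L := fine (\int[Q]_x (l x.1 x.2)%:E).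
have LE : \int[Q]_x (l x.1 x.2)%:E = L%:E.
  by rewrite fineK//; exact: (integrable_fin_num measurableT iQ).
pose a i := fine (\int[P i]_x (l x.1 x.2)%:E).
have aE i : \int[P i]_x (l x.1 x.2)%:E = (a i)%:E.
  by rewrite fineK//; exact: (integrable_fin_num measurableT (iP i)).
have irQ : Q.-integrable setT (EFin \o r) by exact: (integrableB measurableT iQ ilQ).
have irP i : (P i).-integrable setT (EFin \o r).
  exact: (integrableB measurableT (iP i) (ilP i)).
have rQ : \int[Q]_x (r x)%:E = (L - s)%:E.
  under eq_integral do rewrite EFinB.
  by rewrite (integralB measurableT iQ ilQ) LE intlQ.
have rP i : \int[P i]_x (r x)%:E = (a i - s)%:E.
  under eq_integral do rewrite EFinB.
  by rewrite (integralB measurableT (iP i) (ilP i)) aE intlP.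
pose X i := @hyp_coord _ _ W Z n i.
have iWS i (f : W * Z -> R) : (P i).-integrable setT (EFin \o f) ->
    (law_WS mu A).-integrable setT (fun x => (f (X i x))%:E).
  by apply: integrable_measure_preserving.
have intWS i (f : W * Z -> R) : (P i).-integrable setT (EFin \o f) ->
    \int[law_WS mu A]_x (f (X i x))%:E = \int[P i]_x (f x)%:E.
  by apply: integral_measure_preserving.
(* Used twice: with [r] for the empirical excess risk, and with the loss for the empirical term of
   [gen_error]. *)
have emp_int (f : W * Z -> R) (b : 'I_n -> R) :
    (forall i, (P i).-integrable setT (EFin \o f)) ->
    (forall i, \int[P i]_x (f x)%:E = (b i)%:E) ->
    (law_WS mu A).-integrable setT
      (fun x => (n%:R^-1 * \sum_(i < n) f (X i x))%R%:E) /\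
    \int[law_WS mu A]_x (n%:R^-1 * \sum_(i < n) f (X i x))%R%:E =
      (n%:R^-1 * \sum_(i < n) b i)%R%:E.
  move=> fi fb.
  have isum : (law_WS mu A).-integrable setT
      (fun x => (\sum_(i < n) f (X i x))%R%:E).
    under eq_fun do rewrite -sumEFin.
    by apply: integrable_sum => // i _; exact: iWS.
  split; first by under eq_fun do rewrite EFinM; exact: integrableZl.
  under eq_integral do rewrite EFinM.
  rewrite integralZl// EFinM; congr (_ * _).
  under eq_integral do rewrite -sumEFin.
  rewrite integral_sum// -?sumEFin; last by move=> i; exact: iWS.
  by apply: eq_bigr => i _; rewrite intWS.
have [_ emp_r] := emp_int _ _ irP rP.
have [iemp_l emp_l] := emp_int _ _ iP aE.
set rho := (n%:R^-1 * \sum_(i < n) (a i - s))%R in emp_r.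
have -> : 'E_(law_WS mu A)[fun x => emp_excess_risk l wstar x.1 x.2] = rho%:E.
  by rewrite unlock.
have riskE : risk mu l = fubini_F mu (fun x => (l x.1 x.2)%:E).
  by apply/funext => w; rewrite /risk unlock.
have iriskW : (law_W mu A).-integrable setT (risk mu l).
  by rewrite riskE; exact: (integrable_fubini_F iQ).
have riskW : \int[law_W mu A]_w risk mu l w = L%:E.
  by rewrite riskE (integral12_prod_meas1 iQ).
(* The right-hand side of the central condition is a real number here, so monotonicity of [lne]
   gives a finite exponential moment. *)
have moment : \int[Q]_x (expR (- eta * r x))%:E <= (expR (- c * eta * (L - s)))%:E.
  move: central; rewrite /expected_central unlock rQ -EFinM.
  set e := (X in lne X <= _).
  have e_ge0 : 0 <= e by apply: integral_ge0 => x _; rewrite lee_fin expR_ge0.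
  rewrite -/e => cen; rewrite -lee_lne.
  - by rewrite lne_EFin ?expR_gt0// expRK.
  - by rewrite in_itv/= e_ge0 leey.
  - by rewrite in_itv/= lee_fin expR_ge0 leey.
(* KL >= 0 lets the bound at eta pass to eta' <= eta, without Jensen. *)
have mi_ge i : (eta' * (c * (L - s) - (a i - s)))%:E <= mutual_info mu A i.
  have mi0 := kl_div_ge0 (P i) Q.
  have ier : (P i).-integrable setT (EFin \o (fun x => - eta * r x)%R).
    exact: (integrableZl _ _ (irP i)).
  have := kl_div_ge_exp_moment (P i) Q ier moment.
  under eq_integral do rewrite EFinM.
  rewrite integralZl//; last exact: irP.
  rewrite rP -EFinM -EFinB -/(mutual_info mu A i).
  rewrite -[kl_div _ _]/(mutual_info mu A i) in mi0 *.
  case: (mutual_info mu A i) mi0 => [m||]; rewrite ?leey// !lee_fin.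
  move=> m_ge0; set t := (c * (L - s) - (a i - s))%R.
  have -> : (- eta * (a i - s) - - c * eta * (L - s) = eta * t)%R.
    by rewrite /t; ring.
  have [t_le0 _|t_gt0] := leP t 0%R.
    by apply: le_trans m_ge0; rewrite pmulr_rle0.
  by apply: le_trans; rewrite ler_pM2r.
have n_gt0' : (0 < n%:R :> R)%R by rewrite ltr0n.
(* Summing [mi_ge] over [i] gives [eta' * n * (c * (L - s) - rho)] on the left; dividing by
   [c * eta' * n] leaves this bound, from which both conclusions follow. *)
have bound : (L - s - c^-1 * rho)%:E <=
    ((c * eta' * n%:R)^-1)%:E * \sum_(i < n) mutual_info mu A i.
  have k_gt0 : (0 < c * eta' * n%:R)%R by rewrite !mulr_gt0.
  apply: (@le_trans _ _ (((c * eta' * n%:R)^-1)%:E *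
      \sum_(i < n) (eta' * (c * (L - s) - (a i - s)))%:E)); last first.
    apply: lee_wpmul2l; first by rewrite lee_fin invr_ge0 ltW.
    by apply: lee_sum => i _.
  rewrite sumEFin -EFinM lee_fin -mulr_sumr sumrB sumr_const card_ord -mulr_natl.
  have -> : (\sum_(i < n) (a i - s) = n%:R * rho)%R.
    by rewrite /rho mulrA divff ?mul1r// gt_eqF.
  rewrite le_eqVlt; apply/orP; left; apply/eqP; field.
  by rewrite !gt_eqF.
split.
(* The expected generalization error is [L - s - rho], which equals [(1 - c) / c * rho] plus the
   left-hand side of [bound]. *)
- have irWS : (law_WS mu A).-integrable setT (fun x => risk mu l x.1).
    exact: (integrable_measure_preserving (P := law_WS mu A) (Q := law_W mu A)
    measurable_fst (fun _ _ => erefl) iriskW).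
  rewrite (integralB measurableT irWS iemp_l).
  rewrite (integral_measure_preserving (P := law_WS mu A) (Q := law_W mu A)
    measurable_fst (fun _ _ => erefl) iriskW).
  rewrite riskW emp_l -EFinB -EFinM.
  apply: le_trans (leeD2l _ bound); rewrite -EFinD lee_fin.
  have -> : (n%:R^-1 * \sum_(i < n) a i = rho + s)%R.
    rewrite /rho sumrB sumr_const card_ord -mulr_natl; field.
    by rewrite gt_eqF.
  by rewrite le_eqVlt; apply/orP; left; apply/eqP; field; rewrite gt_eqF.
(* The expected excess risk is [L - s], which is [c^-1 * rho] plus the left-hand side of [bound]. *)
- rewrite /excess_risk risk_star integralB//; last first.
    exact: finite_measure_integrable_cst.
  rewrite riskW (probability_integral_cst (law_W mu A)) -EFinB -EFinM.
  apply: le_trans (leeD2l _ bound); rewrite -EFinD lee_fin.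
  by rewrite addrCA subrr addr0.
Qed.
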